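(* Let $n\ge1$, $z=(z_1,\dots,z_n)$, $t$ a formal parameter, and $H(z)\in\mathbb{C}[[z]]^{n}$ with $o(H(z))\ge1$. Let $G_t(z)=z+tN_t(z)$, with $N_t(z)\in\mathbb{C}[[z,t]]^{n}$, be the formal inverse of $F_t(z)=z-tH(z)$. Then for any $U(z)\in\mathbb{C}[[z]]$, the unique power series solution $U_t(z)$ in $z$ and $t$ of the Cauchy problem $$\frac{\partial U_t}{\partial t}=\langle \nabla U_t, N_t\rangle,\qquad U_{t=0}(z)=U(z)$$ is given by $U_t(z)=U(z+tN_t(z))$.
   Context: Vectors are column vectors; $\nabla$ is the gradient with respect to $z$; $\langle\cdot,\cdot\rangle$ is the standard $\mathbb{C}$-bilinear form $\langle a,b\rangle=\sum_i a_ib_i$. For a vector of power series, the order $o(\cdot)$ is the minimum of the orders in $z$ (lowest total degree in $z$) of its components. Composition is in the variables $z$ with $t$ treated as a constant; $G_t$ is the formal inverse of $F_t$ if $F_t(G_t(z))=z=G_t(F_t(z))$. This inverse exists and can always be written $z+tN_t(z)$ with $N_t\in\mathbb{C}[[z,t]]^n$, $o(N_t)\ge1$. ''Power series solution in $z$ and $t$'' means a solution in $\mathbb{C}[[z,t]]$. *)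

(* Defs.v *)
From HB Require Import structures.
From mathcomp Require Import all_boot all_order all_algebra.
From mathcomp Require Import boolp reals.
From mathcomp Require Import complex.
From mathcomp Require Import mpoly.

Set Implicit Arguments.
Unset Strict Implicit.
Unset Printing Implicit Defensive.

Import Order.TTheory GRing.Theory Num.Theory.
Local Open Scope ring_scope.

(* The ring R[[x_0, ..., x_(k-1)]] of formal power series; [f m] is the
   coefficient of the monomial with multi-index [m]. *)
Record fps (R : Type) (k : nat) := Fps { fps_coef :> 'X_{1..k} -> R }.

Notation "'{fps' R [ k ] }" := (fps R k)
  (at level 0, R at level 2, k at level 99, format "'{fps'  R [ k ] }")
  : type_scope.

Lemma fpsP (R : Type) (k : nat) (f g : {fps R[k]}) :
  (forall m, f m = g m) -> f = g.
Proof. by case: f g => [f] [g] /= /funext ->. Qed.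

HB.instance Definition _ (R : Type) (k : nat) := gen_eqMixin {fps R[k]}.
HB.instance Definition _ (R : Type) (k : nat) := gen_choiceMixin {fps R[k]}.

Section FpsRing.
Variables (R : comNzRingType) (k : nat).
Implicit Types f g h : {fps R[k]}.

Definition fps_zero : {fps R[k]} := Fps (fun _ => 0).
Definition fps_opp f : {fps R[k]} := Fps (fun m => - f m).
Definition fps_add f g : {fps R[k]} := Fps (fun m => f m + g m).
Definition fps_one : {fps R[k]} := Fps (fun m => (m == 0%MM)%:R).

(* The degree bound on the pairs only makes the index type finite: it is
   implied by [m = p.1 + p.2]. *)
Definition fps_mul f g : {fps R[k]} :=
  Fps (fun m => \sum_(p : 'X_{1..k < (mdeg m).+1, (mdeg m).+1}
                      | m == (p.1 + p.2)%MM) f p.1 * g p.2).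

Fact fps_addA : associative fps_add.
Proof. by move=> f g h; apply/fpsP => m /=; rewrite addrA. Qed.

Fact fps_addC : commutative fps_add.
Proof. by move=> f g; apply/fpsP => m /=; rewrite addrC. Qed.

Fact fps_add0 : left_id fps_zero fps_add.
Proof. by move=> f; apply/fpsP => m /=; rewrite add0r. Qed.

Fact fps_addN : left_inverse fps_zero fps_opp fps_add.
Proof. by move=> f; apply/fpsP => m /=; rewrite addNr. Qed.

HB.instance Definition _ :=
  GRing.isZmodule.Build {fps R[k]} fps_addA fps_addC fps_add0 fps_addN.

Definition fps_trunc (d : nat) f : {mpoly R[k]} :=
  \sum_(m : 'X_{1..k < d}) f m *: 'X_[m].

Lemma mcoeff_fps_trunc d f m : (mdeg m < d)%N -> (fps_trunc d f)@_m = f m.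
Proof. exact: mcoeff_mpoly. Qed.

Lemma mcoeffM_fps (p q : {mpoly R[k]}) f g m :
  (forall m', (mdeg m' <= mdeg m)%N -> p@_m' = f m') ->
  (forall m', (mdeg m' <= mdeg m)%N -> q@_m' = g m') ->
  (p * q)@_m = fps_mul f g m.
Proof.
move=> pf qg; rewrite mcoeffM /=; apply: eq_bigr => -[a b] _ /=.
by rewrite pf ?qg // -ltnS bmdeg.
Qed.

Lemma fps_truncM d f g m : (mdeg m < d)%N ->
  (fps_trunc d f * fps_trunc d g)@_m = fps_mul f g m.
Proof.
by move=> md; apply: mcoeffM_fps => m' m'm;
  apply: mcoeff_fps_trunc; apply: leq_ltn_trans m'm md.
Qed.

Fact fps_mulC : commutative fps_mul.
Proof.
move=> f g; apply/fpsP => m.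
by rewrite -(fps_truncM f g (ltnSn _)) -(fps_truncM g f (ltnSn _)) mulrC.
Qed.

Fact fps_mulA : associative fps_mul.
Proof.
move=> f g h; apply/fpsP => m; set d := (mdeg m).+1.
transitivity (fps_trunc d f * (fps_trunc d g * fps_trunc d h))@_m.
  apply/esym/mcoeffM_fps => m' m'm; first exact: mcoeff_fps_trunc.
  exact: fps_truncM.
rewrite mulrA; apply: mcoeffM_fps => m' m'm; last exact: mcoeff_fps_trunc.
exact: fps_truncM.
Qed.

Fact fps_mul1 : left_id fps_one fps_mul.
Proof.
move=> f; apply/fpsP => m.
rewrite -(@mcoeffM_fps 1 (fps_trunc (mdeg m).+1 f)) => [|m' _|m' m'm].
- by rewrite mul1r mcoeff_fps_trunc.
- by rewrite mcoeff1.
- exact: mcoeff_fps_trunc.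
Qed.

Fact fps_mulDl : left_distributive fps_mul fps_add.
Proof.
move=> f g h; apply/fpsP => m /=; rewrite -big_split /=.
by apply: eq_bigr => p _; rewrite mulrDl.
Qed.

Fact fps_one_neq0 : fps_one != 0.
Proof.
apply/eqP => /(congr1 (fun f : {fps R[k]} => f 0%MM)) /=.
by rewrite eqxx => /eqP; rewrite oner_eq0.
Qed.

HB.instance Definition _ :=
  GRing.Zmodule_isComNzRing.Build {fps R[k]}
    fps_mulA fps_mulC fps_mul1 fps_mulDl fps_one_neq0.

Definition fpsX (i : 'I_k) : {fps R[k]} := Fps (fun m => (m == U_(i)%MM)%:R).

Definition fps_deriv (i : 'I_k) f : {fps R[k]} :=
  Fps (fun m => f (m + U_(i))%MM *+ (m i).+1).

(* o(f) >= d for a vector f of power series. *)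
Definition fps_order_ge (n d : nat) (f : 'cV[{fps R[k]}]_n) : Prop :=
  forall (i : 'I_n) (m : 'X_{1..k}), (mdeg m < d)%N -> f i 0 m = 0.

End FpsRing.

(* Substitution f(g_0, ..., g_(k-1)), meaningful when every g_i has zero
   constant term.  Then \prod_i g_i ^+ a_i has order at least |a|, so only the
   multi-indices a with |a| <= |m| contribute to the coefficient at m. *)
Definition fps_comp (R : comNzRingType) (k l : nat)
    (f : {fps R[k]}) (g : 'cV[{fps R[l]}]_k) : {fps R[l]} :=
  Fps (fun m => \sum_(a : 'X_{1..k < (mdeg m).+1})
                  f a * (\prod_(i < k) g i 0 ^+ a i) m).

Definition fps_compv (R : comNzRingType) (n k l : nat)
    (f : 'cV[{fps R[k]}]_n) (g : 'cV[{fps R[l]}]_k) : 'cV[{fps R[l]}]_n :=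
  \col_i fps_comp (f i 0) g.

(* The standard bilinear form on column vectors. *)
Definition bform (A : pzRingType) (n : nat) (a b : 'cV[A]_n) : A :=
  \sum_(i < n) a i 0 * b i 0.

(* R[[z]] is {fps R[n]} and R[[z, t]] is {fps R[n + 1]}, whose first n
   variables are z and whose last one is t. *)
Section ParametricSeries.
Variables (R : comNzRingType) (n : nat).

Definition z0 : 'cV[{fps R[n]}]_n := \col_i fpsX R i.
Definition z : 'cV[{fps R[n + 1]}]_n := \col_i fpsX R (lshift 1 i).
Definition t : {fps R[n + 1]} := fpsX R (rshift n ord0).

Definition dt (f : {fps R[n + 1]}) : {fps R[n + 1]} :=
  fps_deriv (rshift n ord0) f.

Definition grad (f : {fps R[n + 1]}) : 'cV[{fps R[n + 1]}]_n :=
  \col_i fps_deriv (lshift 1 i) f.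

(* f_t(z) at t = 0. *)
Definition at_t0 (f : {fps R[n + 1]}) : {fps R[n]} :=
  fps_comp f (col_mx z0 (0 : 'cV_1)).

(* Composition f_t(g_t(z)) in the variables z, with t kept fixed. *)
Definition compz (f g : 'cV[{fps R[n + 1]}]_n) : 'cV[{fps R[n + 1]}]_n :=
  fps_compv f (col_mx g (const_mx t : 'cV_1)).

Definition formal_inverse (f g : 'cV[{fps R[n + 1]}]_n) : Prop :=
  compz f g = z /\ compz g f = z.

Definition cauchy_solution (N : 'cV[{fps R[n + 1]}]_n) (U : {fps R[n]})
    (V : {fps R[n + 1]}) : Prop :=
  dt V = bform (grad V) N /\ at_t0 V = U.

End ParametricSeries.

Arguments z0 {R n}.
Arguments z {R n}.
Arguments t {R n}.

(* Main.v *)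
(* Put G = z + t N.  The identity F(G) = z says G = z + t H(G), that is
   N = H(G); differentiating it in z and in t gives (1 - t DH(G)) DG = 1 and
   (1 - t DH(G)) dG/dt = N, so dG/dt = DG N, and by the chain rule U(G) solves
   the Cauchy problem.  Conversely, the equation expresses the coefficients of
   a solution of t-degree d + 1 through those of t-degree at most d, so the
   initial value determines the solution.

   Identities between compositions of series are checked modulo order d, where
   the outer series may be replaced by a polynomial. *)
Require Import Defs.
From HB Require Import structures.
From mathcomp Require Import all_boot all_order all_algebra.
From mathcomp Require Import boolp reals.
From mathcomp Require Import complex.
From mathcomp Require Import mpoly.
From mathcomp Require Import zify.

Import Order.TTheory GRing.Theory Num.Theory.
Local Open Scope ring_scope.

Set Implicit Arguments.
Unset Strict Implicit.
Unset Printing Implicit Defensive.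

(** Monomials are products of variables, so identities about evaluation and derivation of
    polynomials need checking only on constants and variables, given stability under sums and
    products. *)
Lemma mpoly_alg_ind (R : comNzRingType) k (P : {mpoly R[k]} -> Prop) :
  (forall c, P c%:MP) -> (forall i, P 'X_i) ->
  (forall p q, P p -> P q -> P (p + q)) ->
  (forall p q, P p -> P q -> P (p * q)) -> forall p, P p.
Proof.
move=> PC PX PD PM; apply: mpolyind => [|c m p _ _ Pp].
  by rewrite -mpolyC0.
apply: (PD _ _ _ Pp); rewrite -mul_mpolyC; apply: (PM _ _ (PC c)).
rewrite mpolyXE_id; apply: big_ind => // [|i _]; first exact: PC.
by elim: (m i) => [|e IH]; [exact: PC | rewrite exprS; apply: PM].
Qed.

(** * Power series modulo order [d], and their derivatives *)

Section FpsTheory.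
Variables (R : comNzRingType) (k : nat).
Implicit Types (f g h : {fps R[k]}) (p q : {mpoly R[k]}) (m : 'X_{1..k}).

Lemma fpsD_coef f g m : (f + g) m = f m + g m. Proof. by []. Qed.

Lemma fpsB_coef f g m : (f - g) m = f m - g m. Proof. by []. Qed.

Lemma fpsM_coef f g m :
  (f * g) m = \sum_(p : 'X_{1..k < (mdeg m).+1, (mdeg m).+1}
                      | m == (p.1 + p.2)%MM) f p.1 * g p.2.
Proof. by []. Qed.

Lemma fps_sum_coef (I : Type) (r : seq I) (P : pred I) (F : I -> {fps R[k]}) m :
  (\sum_(i <- r | P i) F i) m = \sum_(i <- r | P i) F i m.
Proof.
exact: (big_morph (fun f : {fps R[k]} => f m) (id1 := 0) (op1 := +%R)).
Qed.

Definition fps_of_mpoly p : {fps R[k]} := Fps (fun m => p@_m).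

Fact fps_of_mpoly_is_zmod_morphism : zmod_morphism fps_of_mpoly.
Proof. by move=> p q; apply/fpsP => m /=; rewrite mcoeffB. Qed.

Fact fps_of_mpoly_is_monoid_morphism : monoid_morphism fps_of_mpoly.
Proof.
split=> [|p q]; first by apply/fpsP => m /=; rewrite mcoeff1.
by apply/fpsP => m; apply: mcoeffM_fps.
Qed.

HB.instance Definition _ :=
  GRing.isZmodMorphism.Build _ _ fps_of_mpoly fps_of_mpoly_is_zmod_morphism.
HB.instance Definition _ :=
  GRing.isMonoidMorphism.Build _ _ fps_of_mpoly fps_of_mpoly_is_monoid_morphism.

Lemma fps_of_mpolyD p q :
  fps_of_mpoly (p + q) = fps_of_mpoly p + fps_of_mpoly q.
Proof. exact: rmorphD. Qed.

Lemma fps_of_mpolyM p q :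
  fps_of_mpoly (p * q) = fps_of_mpoly p * fps_of_mpoly q.
Proof. exact: rmorphM. Qed.

Lemma fps_of_mpolyX i : fps_of_mpoly 'X_i = fpsX R i.
Proof. by apply/fpsP => m /=; rewrite mcoeffX eq_sym. Qed.

Definition fpsC (c : R) : {fps R[k]} := fps_of_mpoly c%:MP.

HB.instance Definition _ := GRing.RMorphism.copy fpsC
  (fps_of_mpoly \o @mpolyC k R).

Lemma fpsCM_coef c f m : (fpsC c * f) m = c * f m.
Proof.
have -> : (fpsC c * f) m = (c%:MP * fps_trunc (mdeg m).+1 f)@_m.
  by apply/esym/mcoeffM_fps => // m' m'm; exact: mcoeff_fps_trunc.
by rewrite mcoeffCM mcoeff_fps_trunc.
Qed.

(* Congruence modulo the series of order at least [d]. *)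
Definition fps_eq d f g := forall m, (mdeg m < d)%N -> f m = g m.

Lemma fps_eqD d f f' g g' :
  fps_eq d f f' -> fps_eq d g g' -> fps_eq d (f + g) (f' + g').
Proof. by move=> ff' gg' m md; rewrite !fpsD_coef ff' ?gg'. Qed.

Lemma fps_eqM d f f' g g' :
  fps_eq d f f' -> fps_eq d g g' -> fps_eq d (f * g) (f' * g').
Proof.
move=> ff' gg' m md; rewrite !fpsM_coef; apply: eq_bigr => -[a b] _ /=.
by rewrite ff' ?gg' // (leq_trans _ md) // bmdeg.
Qed.

Lemma fps_eq_sum0 d (I : Type) (r : seq I) (P : pred I) (F : I -> {fps R[k]}) :
  (forall i, P i -> fps_eq d (F i) 0) -> fps_eq d (\sum_(i <- r | P i) F i) 0.
Proof. by move=> F0 m md; rewrite fps_sum_coef big1 // => i Pi; apply: F0. Qed.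

(** If |p| + |q| < a + b, then |p| < a or |q| < b, so one factor of each term of the product
    vanishes. *)
Lemma fps_eq_mul0 a b f g :
  fps_eq a f 0 -> fps_eq b g 0 -> fps_eq (a + b) (f * g) 0.
Proof.
move=> f0 g0 m; rewrite fpsM_coef => md; apply: big1 => -[p q] /= /eqP mE.
have [pa|ap] := ltnP (mdeg p) a; first by rewrite f0 // mul0r.
by rewrite g0 ?mulr0 //; move: md (congr1 mdeg mE); rewrite mdegD; lia.
Qed.

Lemma fps_eq_trunc d f : fps_eq d (fps_of_mpoly (fps_trunc d f)) f.
Proof. by move=> m md /=; rewrite mcoeff_fps_trunc. Qed.

Lemma fps_eq_ext f g : (forall d, fps_eq d f g) -> f = g.
Proof. by move=> fg; apply/fpsP => m; apply: (fg (mdeg m).+1). Qed.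

Lemma fps_derivD i f g : fps_deriv i (f + g) = fps_deriv i f + fps_deriv i g.
Proof. by apply/fpsP => m /=; rewrite mulrnDl. Qed.

Lemma fps_derivB i f g : fps_deriv i (f - g) = fps_deriv i f - fps_deriv i g.
Proof. by apply/fpsP => m /=; rewrite mulrnBl. Qed.

Lemma fps_deriv_eq d i f g :
  fps_eq d.+1 f g -> fps_eq d (fps_deriv i f) (fps_deriv i g).
Proof. by move=> fg m md /=; rewrite fg // mdegD mdeg1 addn1. Qed.

Lemma fps_deriv_mpoly i p : fps_deriv i (fps_of_mpoly p) = fps_of_mpoly p^`M(i).
Proof. by apply/fpsP => m /=; rewrite mcoeff_deriv. Qed.

(** The Leibniz rule is inherited from polynomials. Truncation is at [d.+1] because a derivative
    known modulo order d requires the series modulo order d + 1. *)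
Lemma fps_derivM i f g :
  fps_deriv i (f * g) = fps_deriv i f * g + f * fps_deriv i g.
Proof.
apply: fps_eq_ext => d; set p := fps_trunc d.+1 f; set q := fps_trunc d.+1 g.
have pf : fps_eq d.+1 (fps_of_mpoly p) f := @fps_eq_trunc _ _.
have qg : fps_eq d.+1 (fps_of_mpoly q) g := @fps_eq_trunc _ _.
have W u v : fps_eq d.+1 u v -> fps_eq d u v by move=> uv m md; apply/uv/ltnW.
have E : fps_eq d (fps_deriv i (fps_of_mpoly (p * q))) (fps_deriv i (f * g)).
  by apply: fps_deriv_eq; rewrite fps_of_mpolyM; apply: fps_eqM.
move=> m md; rewrite -E // fps_deriv_mpoly mderivM fps_of_mpolyD !fps_of_mpolyM.
rewrite -!fps_deriv_mpoly; apply: fps_eqD md; apply: fps_eqM;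
  by [apply: fps_deriv_eq | apply: W].
Qed.

Lemma mderivXU (i j : 'I_k) : ('X_j : {mpoly R[k]})^`M(i) = (i == j)%:R.
Proof.
rewrite mderivX mnm1E eq_sym; case: eqP => [->|_]; last by rewrite scale0r.
suff -> : (U_(j) - U_(j) = 0)%MM by rewrite mpolyX0 scale1r.
by apply/mnmP => r; rewrite mnmBE subnn mnm0E.
Qed.

Lemma fps_derivX (i j : 'I_k) :
  fps_deriv i (fpsX R j) = (i == j)%:R :> {fps R[k]}.
Proof.
by rewrite -fps_of_mpolyX fps_deriv_mpoly mderivXU; exact: rmorph_nat.
Qed.

Lemma fps_derivC (i : 'I_k) c : fps_deriv i (fpsC c) = 0.
Proof. by rewrite /fpsC fps_deriv_mpoly mderivC rmorph0. Qed.

Lemma fpsX_mul_coef i f m : (fpsX R i * f) (m + U_(i))%MM = f m.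
Proof.
pose q := fps_trunc (mdeg (m + U_(i))).+1 f.
have -> : (fpsX R i * f) (m + U_(i))%MM = ('X_i * q)@_(m + U_(i)).
  apply/esym/mcoeffM_fps => m' m'm; first by rewrite -fps_of_mpolyX.
  exact: mcoeff_fps_trunc.
by rewrite mulrC addmC mcoeffMX mcoeff_fps_trunc // mdegD ltnS leq_addr.
Qed.

(** Multiplying by a variable only shifts coefficients; this is what allows t to be cancelled from t
    N = t H(G). *)
Lemma fpsX_mul_inj (i : 'I_k) : injective ( *%R (fpsX R i)).
Proof.
move=> f g fg; apply/fpsP => m.
by rewrite -(fpsX_mul_coef i f) fg fpsX_mul_coef.
Qed.

End FpsTheory.

(** * Substitution: morphism property and chain rule *)

Section FpsComp.
Variables (R : comNzRingType) (k l : nat) (g : 'cV[{fps R[l]}]_k).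
Implicit Types (f : {fps R[k]}) (p : {mpoly R[k]}).

(** The polynomial counterpart of [fps_comp], a ring morphism by construction. *)
Definition fps_eval : {mpoly R[k]} -> {fps R[l]} :=
  mmap (@fpsC R l) (fun i => g i 0).

HB.instance Definition _ := GRing.RMorphism.copy fps_eval
  (mmap (@fpsC R l) (fun i => g i 0)).

Lemma fps_evalC c : fps_eval c%:MP = fpsC l c. Proof. exact: mmapC. Qed.

Lemma fps_evalD p q : fps_eval (p + q) = fps_eval p + fps_eval q.
Proof. exact: rmorphD. Qed.

Lemma fps_evalM p q : fps_eval (p * q) = fps_eval p * fps_eval q.
Proof. exact: rmorphM. Qed.

Lemma fps_evalX i : fps_eval 'X_i = g i 0.
Proof. by rewrite /fps_eval mmapX mmap1U. Qed.

Lemma fps_deriv_eval i p :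
  fps_deriv i (fps_eval p) =
  \sum_j fps_eval p^`M(j) * fps_deriv i (g j 0).
Proof.
elim/mpoly_alg_ind: p => [c|j|p q IHp IHq|p q IHp IHq].
- rewrite fps_evalC fps_derivC big1 // => j _.
  by rewrite mderivC rmorph0 mul0r.
- rewrite fps_evalX (bigD1 j) //= mderivXU eqxx rmorph1 mul1r big1 ?addr0 //.
  by move=> j' /negPf jj'; rewrite mderivXU jj' rmorph0 mul0r.
- rewrite fps_evalD fps_derivD IHp IHq -big_split /=; apply: eq_bigr => j _.
  by rewrite mderivD fps_evalD mulrDl.
- rewrite fps_evalM fps_derivM IHp IHq mulr_suml mulr_sumr -big_split /=.
  apply: eq_bigr => j _; rewrite mderivM fps_evalD !fps_evalM mulrDl.
  by congr (_ + _); rewrite ?mulrA // mulrAC.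
Qed.

Lemma fps_compD f h : fps_comp (f + h) g = fps_comp f g + fps_comp h g.
Proof.
by apply/fpsP => m /=; rewrite -big_split; apply: eq_bigr => a _; apply: mulrDl.
Qed.

Lemma fps_compB f h : fps_comp (f - h) g = fps_comp f g - fps_comp h g.
Proof.
apply/fpsP => m /=; rewrite -sumrN -big_split.
by apply: eq_bigr => a _; apply: mulrBl.
Qed.

Hypothesis g0 : fps_order_ge 1 g.

Lemma mmap1_order (a : 'X_{1..k}) :
  fps_eq (mdeg a) (mmap1 (fun i => g i 0) a) 0.
Proof.
rewrite /mmap1 mdegE.
apply: (big_rec2 (fun d (f : {fps R[l]}) => fps_eq d f 0)) => // i d f _ df.
apply: (fps_eq_mul0 _ df); elim: (a i) => // e IH; rewrite exprS -add1n.
by apply: fps_eq_mul0 IH => m; apply: g0.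
Qed.

Lemma fps_eval_order d p :
  (forall a, (mdeg a < d)%N -> p@_a = 0) -> fps_eq d (fps_eval p) 0.
Proof.
move=> p0; rewrite /fps_eval /mmap; apply: fps_eq_sum0 => a _.
have [/p0 -> //|da] := ltnP (mdeg a) d; first by rewrite rmorph0 mul0r.
move=> m md; rewrite fpsCM_coef (mmap1_order (leq_trans md da)).
exact: mulr0.
Qed.

(** The bridge from series to polynomials. At m, [fps_comp] agrees with the evaluation of the
    truncation [q] of f; [q - p] has only monomials of degree above |m|, and these evaluate to
    series of order above |m| because g has no constant term. *)
Lemma fps_compE d f p :
  fps_eq d (fps_of_mpoly p) f -> fps_eq d (fps_comp f g) (fps_eval p).
Proof.
move=> pf m md; set q := fps_trunc (mdeg m).+1 f.
have -> : fps_comp f g m = fps_eval q m.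
  rewrite /q raddf_sum /= fps_sum_coef; apply: eq_bigr => a _.
  by rewrite /fps_eval mmapZ mmapX fpsCM_coef.
apply/eqP; rewrite -subr_eq0 -fpsB_coef -rmorphB; apply/eqP.
apply: (@fps_eval_order (mdeg m).+1) => // a am.
rewrite mcoeffB mcoeff_fps_trunc // -(pf a) ?subrr //.
exact: leq_trans am md.
Qed.

Lemma fps_comp_mpoly p : fps_comp (fps_of_mpoly p) g = fps_eval p.
Proof. by apply: fps_eq_ext => d; apply: fps_compE. Qed.

Lemma fps_compM f h : fps_comp (f * h) g = fps_comp f g * fps_comp h g.
Proof.
apply: fps_eq_ext => d.
pose p := fps_trunc d f; pose q := fps_trunc d h.
have pf : fps_eq d (fps_of_mpoly p) f := @fps_eq_trunc _ _ _ _.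
have qh : fps_eq d (fps_of_mpoly q) h := @fps_eq_trunc _ _ _ _.
move=> m md; rewrite (@fps_compE d _ (p * q)) //; last first.
  by rewrite fps_of_mpolyM; apply: fps_eqM.
rewrite fps_evalM; apply: fps_eqM md => a ad; apply/esym.
  exact: fps_compE ad.
exact: fps_compE ad.
Qed.

Lemma fps_compX i : fps_comp (fpsX R i) g = g i 0.
Proof. by rewrite -fps_of_mpolyX fps_comp_mpoly fps_evalX. Qed.

Lemma fps_compC c : fps_comp (fpsC k c) g = fpsC l c.
Proof. by rewrite fps_comp_mpoly fps_evalC. Qed.

(** The chain rule for a polynomial truncation of f, one degree further than d to absorb the loss
    under differentiation. *)
Lemma fps_deriv_comp i f :
  fps_deriv i (fps_comp f g) =
  \sum_j fps_comp (fps_deriv j f) g * fps_deriv i (g j 0).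
Proof.
apply: fps_eq_ext => d; pose p := fps_trunc d.+1 f.
have pf : fps_eq d.+1 (fps_of_mpoly p) f := @fps_eq_trunc _ _ _ _.
move=> m md; rewrite (fps_deriv_eq i (fps_compE pf)) // fps_deriv_eval.
rewrite !fps_sum_coef; apply: eq_bigr => j _; apply: fps_eqM md => // a ad.
apply/esym; apply: fps_compE ad; rewrite -fps_deriv_mpoly.
exact: fps_deriv_eq.
Qed.

End FpsComp.

(** * Associativity and identity of substitution *)

Lemma fps_order_comp (R : comNzRingType) n k l
    (f : 'cV[{fps R[k]}]_n) (g : 'cV[{fps R[l]}]_k) :
  fps_order_ge 1 f -> fps_order_ge 1 (fps_compv f g).
Proof.
move=> f0 i m; rewrite ltnS leqn0 => /eqP m0; rewrite mxE /=.
apply: big1 => -[a /= am] _; rewrite f0 ?mul0r //.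
by rewrite m0 in am.
Qed.

Lemma fps_compA (R : comNzRingType) k l r (f : {fps R[k]})
    (g : 'cV[{fps R[l]}]_k) (h : 'cV[{fps R[r]}]_l) :
  fps_order_ge 1 g -> fps_order_ge 1 h ->
  fps_comp (fps_comp f g) h = fps_comp f (fps_compv g h).
Proof.
move=> g0 h0; have gh0 := fps_order_comp h g0.
have evalA p : fps_comp (fps_eval g p) h = fps_eval (fps_compv g h) p.
  elim/mpoly_alg_ind: p => [c|i|p q IHp IHq|p q IHp IHq].
  - by rewrite !fps_evalC fps_compC.
  - by rewrite !fps_evalX mxE.
  - by rewrite !fps_evalD fps_compD IHp IHq.
  - by rewrite !fps_evalM fps_compM // IHp IHq.
apply: fps_eq_ext => d; pose p := fps_trunc d f.
have pf : fps_eq d (fps_of_mpoly p) f := @fps_eq_trunc _ _ _ _.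
move=> m md; rewrite (fps_compE gh0 pf md) -evalA.
(* The coefficient at m of the outer composite reads the inner one only at degrees at most |m| < d,
   where f may be replaced by p. *)
apply: eq_bigr => a _; congr (_ * _); apply: (fps_compE g0 pf).
exact: leq_trans (bmdeg a) md.
Qed.

Lemma fps_eval_z0 (R : comNzRingType) n (p : {mpoly R[n]}) :
  fps_eval z0 p = fps_of_mpoly p.
Proof.
elim/mpoly_alg_ind: p => [c|i|p q IHp IHq|p q IHp IHq].
- exact: fps_evalC.
- by rewrite fps_evalX mxE fps_of_mpolyX.
- by rewrite fps_evalD fps_of_mpolyD IHp IHq.
- by rewrite fps_evalM fps_of_mpolyM IHp IHq.
Qed.

Lemma fpsX_order (R : comNzRingType) k (i : 'I_k) : fps_eq 1 (fpsX R i) 0.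
Proof.
move=> m; rewrite ltnS leqn0 mdeg_eq0 => /eqP -> /=.
by rewrite eq_sym mnm1_eq0.
Qed.

Lemma fps_comp_z0 (R : comNzRingType) n (f : {fps R[n]}) : fps_comp f z0 = f.
Proof.
have z00 : fps_order_ge 1 (@z0 R n).
  by move=> i m md; rewrite mxE fpsX_order.
apply: fps_eq_ext => d m md.
rewrite (@fps_compE _ _ _ _ z00 d _ (fps_trunc d f)) ?fps_eval_z0 //.
all: exact: fps_eq_trunc.
Qed.

(** * The formal inverse and existence for the Cauchy problem *)

Section FormalInverse.
Variables (R : comNzRingType) (n : nat).
Implicit Types (G N : 'cV[{fps R[n + 1]}]_n) (H : 'cV[{fps R[n]}]_n).

Lemma z_order : fps_order_ge 1 (@z R n).
Proof. by move=> i m md; rewrite mxE fpsX_order. Qed.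

Lemma z_addt_order N : fps_order_ge 1 (z + t *: N).
Proof.
move=> i m md; rewrite !mxE fpsD_coef fpsX_order // add0r.
(* The series t has order 1 and N is only known to have order at least 0. *)
by apply: (@fps_eq_mul0 _ _ 1 0) md => //; exact: fpsX_order.
Qed.

Lemma col_mx_t_order G :
  fps_order_ge 1 G -> fps_order_ge 1 (col_mx G (const_mx t : 'cV_1)).
Proof.
move=> G0 i m md; rewrite mxE; case: splitP => j _; first exact: G0.
by rewrite mxE fpsX_order.
Qed.

Lemma compv_z_col_mx G :
  fps_order_ge 1 G -> fps_compv z (col_mx G (const_mx t : 'cV_1)) = G.
Proof.
move=> G0; apply/colP => i; rewrite !mxE fps_compX ?col_mxEu //.
exact: col_mx_t_order.
Qed.

Lemma compz_z_sub_tH G H : fps_order_ge 1 G ->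
  compz (z - t *: fps_compv H z) G = G - t *: fps_compv H G.
Proof.
move=> G0; have G0' := col_mx_t_order G0.
apply/colP => i; rewrite !mxE fps_compB fps_compM // !fps_compX //.
rewrite fps_compA ?compv_z_col_mx //; last exact: z_order.
by rewrite col_mxEu col_mxEd mxE.
Qed.

Lemma formal_inverse_fixpoint H N :
  compz (z - t *: fps_compv H z) (z + t *: N) = z ->
  N = fps_compv H (z + t *: N).
Proof.
rewrite compz_z_sub_tH; last exact: z_addt_order.
move=> /eqP; rewrite subr_eq => /eqP/addrI tN.
apply/colP => i; apply: (fpsX_mul_inj (i := rshift n ord0)).
by move/colP/(_ i): tN; rewrite !mxE.
Qed.

(* With [A = 1 - t DH(G)], differentiating [G = z + t H(G)] gives
   [A * D_z G = 1] and [A * dG/dt = N], so [dG/dt = D_z G * N]. *)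
Lemma dt_fixpoint H N (G := z + t *: N) i :
  N = fps_compv H G -> dt (G i 0) = bform (grad (G i 0)) N.
Proof.
move=> NE; have G0 : fps_order_ge 1 G := z_addt_order N.
have GE : G = z + t *: N by [].
move: NE; clearbody G => NE.
pose J := \matrix_(i, j) fps_deriv (lshift 1 j) (G i 0).
pose DH := \matrix_(i, j) fps_comp (fps_deriv j (H i 0)) G.
pose T : 'cV_n := \col_i dt (G i 0).
(* The fixed-point equation is differentiated along an arbitrary variable [v]: one of the z for
   [AJ], and t for [AT]. *)
have DG v j : fps_deriv v (G j 0) = fps_deriv v (z j 0) +
    (fps_deriv v t * N j 0 + t * \sum_k DH j k * fps_deriv v (G k 0)).
  have -> : G j 0 = z j 0 + t * N j 0 by rewrite GE !mxE.
  rewrite fps_derivD fps_derivM; congr (_ + (_ + _)).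
  rewrite {1}NE mxE fps_deriv_comp //; congr (_ * _).
  by apply: eq_bigr => r _; rewrite [DH _ _]mxE.
have AJ : (1%:M - t *: DH) *m J = 1%:M.
  apply/matrixP => j v; rewrite mulmxBl mul1mx -scalemxAl !mxE DG !mxE.
  rewrite !fps_derivX (inj_eq (@lshift_inj _ _)) eq_lrshift mul0r add0r.
  rewrite eq_sym [X in t * X](eq_bigr (fun k => DH j k * J k v)) ?addrK //.
  by move=> r _; rewrite [J _ _]mxE.
have AT : (1%:M - t *: DH) *m T = N.
  apply/colP => j; rewrite mulmxBl mul1mx -scalemxAl !mxE /dt DG !mxE.
  rewrite !fps_derivX eq_rlshift eqxx mul1r add0r.
  rewrite [X in t * X](eq_bigr (fun k => DH j k * T k 0)) ?addrK //.
  by move=> r _; rewrite [T _ _]mxE.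
(* Over a commutative ring a right inverse of a square matrix is also a left inverse, so multiplying
   A T = N by J isolates T. *)
have TE : T = J *m N by rewrite -AT mulmxA (mulmx1C AJ) mul1mx.
move/colP/(_ i): TE; rewrite !mxE => ->.
by apply: eq_bigr => j _; rewrite !mxE.
Qed.

(** The chain rule in t and in each z_j reduces the claim to the same equation for the components of
    G, after exchanging two sums. *)
Lemma dt_comp_fixpoint H N (G := z + t *: N) U :
  N = fps_compv H G -> dt (fps_comp U G) = bform (grad (fps_comp U G)) N.
Proof.
move=> NE; have G0 : fps_order_ge 1 G := z_addt_order N.
rewrite /dt fps_deriv_comp //.
under eq_bigr => i _ do rewrite -/(dt _) (dt_fixpoint _ NE) /bform mulr_sumr.
rewrite exchange_big; apply: eq_bigr => j _ /=.
rewrite mxE fps_deriv_comp // mulr_suml.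
by apply: eq_bigr => i _; rewrite mxE mulrA.
Qed.

Lemma col_z0_order : fps_order_ge 1 (col_mx (@z0 R n) (0 : 'cV_1)).
Proof.
move=> i m md; rewrite mxE; case: splitP => j _; last by rewrite mxE.
by rewrite mxE fpsX_order.
Qed.

Lemma at_t0_comp N U : at_t0 (fps_comp U (z + t *: N)) = U.
Proof.
rewrite /at_t0 fps_compA; [|exact: z_addt_order|exact: col_z0_order].
rewrite -[RHS]fps_comp_z0; congr fps_comp; apply/colP => i.
have C0 := col_z0_order; rewrite !mxE fps_compD fps_compM // !fps_compX //.
by rewrite col_mxEu col_mxEd !mxE mul0r addr0.
Qed.

(** Links the initial condition, defined by substitution, to coefficients: setting t = 0 keeps
    exactly the monomials free of t. *)
Lemma at_t0_coef (f : {fps R[n + 1]}) (m : 'X_{1..n + 1}) :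
  m (rshift n ord0) = 0%N ->
  f m = at_t0 f [multinom m (lshift 1 i) | i < n].
Proof.
move=> mt; set m0 := [multinom _ | i < n].
have mdE (a : 'X_{1..n + 1}) : mdeg a =
    (mdeg [multinom a (lshift 1 i) | i < n] + a (rshift n ord0))%N.
  rewrite !mdegE big_split_ord big_ord1; congr (_ + _)%N.
  by apply: eq_bigr => i _; rewrite mnmE.
have prodE (a : 'X_{1..n + 1}) :
    (\prod_i col_mx (@z0 R n) (0 : 'cV_1) i 0 ^+ a i) m0 = (a == m)%:R.
  rewrite big_split_ord big_ord1 col_mxEd mxE.
  pose a0 := [multinom a (lshift 1 i) | i < n].
  rewrite (_ : \prod_(i < n) _ = fps_of_mpoly 'X_[a0]); last first.
    rewrite mpolyXE_id rmorph_prod; apply: eq_bigr => i _.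
    by rewrite rmorphXn /= fps_of_mpolyX col_mxEu mxE mnmE.
  have [at0|at0] := eqVneq (a (rshift n ord0)) 0%N.
    rewrite at0 expr0 Monoid.mulm1 /= mcoeffX; congr (nat_of_bool _)%:R.
    apply/eqP/eqP => [/mnmP a0m0|am]; last by rewrite /a0 am.
    apply/mnmP => i.
    case: (split_ordP i) => j ->; first by have := a0m0 j; rewrite !mnmE.
    by rewrite ord1 mt at0.
  (* A positive power of t specialises to 0, and such an [a] differs from [m], which has t-degree
     0. *)
  rewrite expr0n (negPf at0) -[LHS]/((fps_of_mpoly _ * 0) m0) mulr0.
  case: eqP => // am.
  by rewrite am mt eqxx in at0.
(* As |m| = |m0|, the multi-index m lies in the finite range summed by [fps_comp] at [m0]. *)
have mlt : (mdeg m < (mdeg m0).+1)%N by rewrite mdE mt addn0.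
rewrite /at_t0 /= (bigD1 (BMultinom mlt)) //= prodE eqxx mulr1.
rewrite big1 ?addr0 // => a; rewrite -val_eqE /= => am.
by rewrite prodE (negPf am) mulr0.
Qed.

End FormalInverse.

(** * Uniqueness for the Cauchy problem *)

Lemma cauchy_problem_eq0 (R : numDomainType) n (N : 'cV[{fps R[n + 1]}]_n) W :
  cauchy_solution N 0 W -> W = 0.
Proof.
case=> dtW W0; pose tau := rshift n (ord0 : 'I_1).
suff Wm d (m : 'X_{1..n + 1}) : (m tau <= d)%N -> W m = 0.
  by apply/fpsP => m; apply: (Wm (m tau)).
elim: d m => [|d IH] m.
  by rewrite leqn0 => /eqP/at_t0_coef ->; rewrite W0.
rewrite leq_eqVlt => /predU1P[mt|]; last exact: IH.
have mE : m = (m - U_(tau) + U_(tau))%MM.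
  rewrite submK //; apply/mnm_lepP => i; rewrite mnm1E.
  by case: eqP => // <-; rewrite mt.
set m' := (m - U_(tau))%MM in mE.
have m't : m' tau = d by rewrite /m' mnmBE mnm1E eqxx mt subn1.
(* The coefficient of [dt W] at [m'] is d + 1 times [W m], and d + 1 can be cancelled in
   characteristic 0. *)
have : dt W m' = 0; last first.
  by rewrite /= -mE -/tau => /eqP; rewrite mulrn_eq0 => /eqP.
rewrite dtW /bform fps_sum_coef big1 // => i _; rewrite fpsM_coef.
apply: big1 => -[p q] /= /eqP m'E; rewrite mxE /= IH ?mul0rn ?mul0r //.
(* Differentiating in a z-variable reads W at [p] shifted in that variable, so its t-degree is that
   of [p], at most d as p + q = m'. *)
move/mnmP/(_ tau): m'E; rewrite m't mnmDE => ->.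
by rewrite mnmDE mnm1E eq_lrshift addn0 leq_addr.
Qed.

Lemma cauchy_solutionB (R : comNzRingType) n (N : 'cV[{fps R[n + 1]}]_n)
    U1 U2 V1 V2 :
  cauchy_solution N U1 V1 -> cauchy_solution N U2 V2 ->
  cauchy_solution N (U1 - U2) (V1 - V2).
Proof.
move=> [dt1 <-] [dt2 <-]; split; last exact: fps_compB.
rewrite [LHS]fps_derivB -/(dt V1) -/(dt V2) dt1 dt2 -sumrB.
by apply: eq_bigr => i _; rewrite !mxE fps_derivB mulrBl.
Qed.

Theorem proposition2p9 (R : realType) (n : nat) (hn : (1 <= n)%N)
    (H : 'cV[{fps R[i][n]}]_n) (hH : fps_order_ge 1 H)
    (N : 'cV[{fps R[i][n + 1]}]_n)
    (hN : formal_inverse (z - t *: fps_compv H z) (z + t *: N))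
    (U : {fps R[i][n]}) :
  cauchy_solution N U (fps_comp U (z + t *: N)) /\
  (forall V : {fps R[i][n + 1]},
     cauchy_solution N U V -> V = fps_comp U (z + t *: N)).
Proof.
have NE := formal_inverse_fixpoint hN.1.
have sol : cauchy_solution N U (fps_comp U (z + t *: N)).
  by split; [apply: dt_comp_fixpoint NE | apply: at_t0_comp].
split=> // V solV; apply/eqP; rewrite -subr_eq0; apply/eqP.
(* By linearity the difference of two solutions solves the problem with initial value U - U = 0. *)
apply: (@cauchy_problem_eq0 _ _ N); rewrite -(subrr U).
exact: cauchy_solutionB.
Qed.
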